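(* Let $\tau=4/\gamma^2$ with $0<\gamma<2$. Let $b_0,b_1>0$ and let $\beta_{21}(b_0,b_1)$ be a Barnes beta distribution of type $(2,1)$. Let $\rho,s_0\in\mathbb R$ satisfy $$-1\le\rho\le0,\qquad s_0+b_0>0,$$ and consider the following deformation of the Mellin transform of $\beta_{21}(b_0,b_1)$: \begin{align*} \eta_{21}(s,\rho)=\ &\frac{\Gamma_2(s(1+\rho)+b_0-\rho s_0\,|\,\tau)}{\Gamma_2(b_0-\rho s_0\,|\,\tau)}\, \frac{\Gamma_2(b_0+b_1-\rho s_0\,|\,\tau)}{\Gamma_2(s(1+\rho)+b_0+b_1-\rho s_0\,|\,\tau)}\\ &\times\frac{\Gamma_2(-\rho s+b_0\,|\,\tau)}{\Gamma_2(b_0\,|\,\tau)}\, \frac{\Gamma_2(b_0+b_1\,|\,\tau)}{\Gamma_2(-\rho s+b_0+b_1\,|\,\tau)}. \end{align*} Then $\eta_{21}(s,\rho)$ is analytic in $s$ over the same domain as the original Mellin transform, $\operatorname{Re}(s)+b_0>0$; it is the Mellin transform of the random variable $$\beta_{21}^{1+\rho}(b_0-\rho s_0,b_1)\,\beta_{21}^{-\rho}(b_0,b_1)$$ (with independent factors); and it has the same value at $s=s_0$ as the original Mellin transform, $$\eta_{21}(s_0,\rho)=\mathbf{E}[\beta_{21}^{s_0}(b_0,b_1)].$$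
   Context: The Mellin transform of a positive random variable $X$ is $\mathbf{E}[X^s]$. $\Gamma_2(w|\tau)$ is the Barnes double gamma function with periods $1,\tau$, i.e. $\log\Gamma_2(w|\tau)=\partial_z|_{z=0}\zeta_2(z,w)$, where $\zeta_2(z,w)=\sum_{k_1,k_2\ge 0}(w+k_1+k_2\tau)^{-z}$ ($\operatorname{Re} w>0$, $\operatorname{Re} z>2$, analytically continued in $z$). Barnes beta distribution of type $(2,1)$: for $b_0,b_1>0$, $\beta_{21}(b_0,b_1)$ (known to exist) is the positive random variable with $$\mathbf{E}[\beta_{21}^s]=\frac{\Gamma_2(s+b_0|\tau)}{\Gamma_2(b_0|\tau)}\frac{\Gamma_2(b_0+b_1|\tau)}{\Gamma_2(s+b_0+b_1|\tau)},\qquad \operatorname{Re}(s)>-b_0.$$ *)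

(* Defs.v *)
From HB Require Import structures.
From mathcomp Require Import all_boot all_order all_algebra.
From mathcomp Require Import complex.
From mathcomp Require Import all_classical all_reals all_analysis.

Set Implicit Arguments.
Unset Strict Implicit.
Unset Printing Implicit Defensive.

Import Order.TTheory GRing.Theory Num.Theory.
Import numFieldNormedType.Exports.

Local Open Scope classical_set_scope.
Local Open Scope ring_scope.
Local Open Scope complex_scope.

Definition cexp (R : realType) (z : R[i]) : R[i] :=
  (expR (complex.Re z))%:C * (cos (complex.Im z) +i* sin (complex.Im z)).

(* Principal logarithm; the formula for the argument is only correct when
   [0 < Re w], which is the only case in which it is used. *)
Definition clog_rhp (R : realType) (w : R[i]) : R[i] :=
  ln (complex.Re `|w|) +i* atan (complex.Im w / complex.Re w).

Definition cpow_rhp (R : realType) (w z : R[i]) : R[i] := cexp (z * clog_rhp w).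

(* Complex differentiability (in the variable of type [R[i]]) at each point of
   [D]; for open [D] this is analyticity on [D]. *)
Definition holomorphic_on (R : realType) (D : set R[i]) (f : R[i] -> R[i]) :=
  forall z, D z -> derivable (f : R[i]^o -> R[i]^o) z 1.

Definition barnes_zeta2_partial (R : realType) (tau : R) (w z : R[i]) (n : nat)
    : R[i] :=
  \sum_(k1 < n) \sum_(k2 < n)
    cpow_rhp (w + k1%:R + k2%:R * tau%:C) (- z).

(* [Z] is the analytic continuation of [z |-> zeta_2(z, w)]. The double series
   converges absolutely for [Re z > 2], so it is the limit of its square partial
   sums; the continuation is meromorphic with poles exactly at [1] and [2]. *)
Definition is_barnes_zeta2 (R : realType) (tau : R) (w : R[i])
    (Z : R[i] -> R[i]) :=
  holomorphic_on [set z | z != 1 /\ z != 2] Z /\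
  (forall z, 2 < complex.Re z ->
     barnes_zeta2_partial tau w z n @[n --> \oo] --> (Z z : R[i]^o)).

(* The continuation is unique on the connected set [C \ {1, 2}]. *)
Definition barnes_zeta2 (R : realType) (tau : R) (z w : R[i]) : R[i] :=
  xget (fun=> 0) [set Z | is_barnes_zeta2 tau w Z] z.

Definition barnes_gamma2 (R : realType) (w : R[i]) (tau : R) : R[i] :=
  cexp (derive1 (fun z : R[i]^o => barnes_zeta2 tau z w : R[i]^o) 0).

Section mellin.
Context d (T : measurableType d) (R : realType) (P : probability T R).

(* [x ^ s] for real [x > 0] and complex [s] *)
Definition rcpow (x : R) (s : R[i]) : R[i] := cexp (s * (ln x)%:C).

(* [E[X ^ s]], meaningful when [mellin_integrable X s] holds *)
Definition mellin (X : T -> R) (s : R[i]) : R[i] :=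
  (\int[P]_t complex.Re (rcpow (X t) s))%R +i*
  (\int[P]_t complex.Im (rcpow (X t) s))%R.

Definition mellin_integrable (X : T -> R) (s : R[i]) : Prop :=
  P.-integrable setT (fun t => (complex.Re (rcpow (X t) s))%:E) /\
  P.-integrable setT (fun t => (complex.Im (rcpow (X t) s))%:E).

Definition positive_rv (X : T -> R) : Prop :=
  measurable_fun setT X /\ {ae P, forall t, 0 < X t}.

Definition has_mellin_on (X : T -> R) (D : set R[i]) (phi : R[i] -> R[i]) : Prop :=
  positive_rv X /\
  forall s, D s -> mellin_integrable X s /\ mellin X s = phi s.

Definition independent_rv (X Y : T -> R) : Prop :=
  forall A B : set R, measurable A -> measurable B ->
    P (X @^-1` A `&` Y @^-1` B) = (P (X @^-1` A) * P (Y @^-1` B))%E.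

End mellin.

Definition beta21_mellin (R : realType) (tau b0 b1 : R) (s : R[i]) : R[i] :=
  barnes_gamma2 (s + b0%:C) tau / barnes_gamma2 b0%:C tau *
  (barnes_gamma2 (b0 + b1)%:C tau / barnes_gamma2 (s + (b0 + b1)%:C) tau).

Definition is_barnes_beta21 d (T : measurableType d) (R : realType)
    (P : probability T R) (tau b0 b1 : R) (X : T -> R) : Prop :=
  has_mellin_on P X [set s | - b0 < complex.Re s] (beta21_mellin tau b0 b1).

Definition eta21 (R : realType) (tau b0 b1 s0 : R) (s : R[i]) (rho : R) : R[i] :=
  barnes_gamma2 (s * (1 + rho)%:C + (b0 - rho * s0)%:C) tau
    / barnes_gamma2 (b0 - rho * s0)%:C tau *
  (barnes_gamma2 (b0 + b1 - rho * s0)%:C tau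
    / barnes_gamma2 (s * (1 + rho)%:C + (b0 + b1 - rho * s0)%:C) tau) *
  (barnes_gamma2 (- rho%:C * s + b0%:C) tau / barnes_gamma2 b0%:C tau) *
  (barnes_gamma2 (b0 + b1)%:C tau
    / barnes_gamma2 (- rho%:C * s + (b0 + b1)%:C) tau).

(* Main.v *)
Require Import Defs.
From HB Require Import structures.
From mathcomp Require Import all_boot all_order all_algebra.
From mathcomp Require Import complex.
From mathcomp Require Import all_classical all_reals all_analysis.
From mathcomp Require Import measurable_realfun ring lra.

Set Implicit Arguments.
Unset Strict Implicit.
Unset Printing Implicit Defensive.

Import Order.TTheory GRing.Theory Num.Theory.
Import numFieldNormedType.Exports.

Local Open Scope classical_set_scope.
Local Open Scope ring_scope.
Local Open Scope complex_scope.

(** Why the theorem holds. Grouping the factors of [eta21] gives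
    [eta21(s, rho) = M_X(s (1 + rho)) * M_Y(- rho s)], where [M_X] and [M_Y] are
    the Mellin transforms of [X] and [Y] ([eta21E]). When [0 < Re s + b0], the
    two arguments lie in the domains of [M_X] and [M_Y]: the quantities that
    have to be positive,
    [(1 + rho) (Re s + b0) - rho (s0 + b0)] and
    [- rho (Re s + b0) + (1 + rho) b0],
    are convex combinations of positive numbers, and this is where
    [-1 <= rho <= 0] and [0 < s0 + b0] enter.

    Almost surely [(X^a Y^b)^s = X^(a s) Y^(b s)], and by independence the
    expectation of the right-hand side is a product. So [eta21] is the Mellin
    transform of [X^(1 + rho) Y^(- rho)] ([mellin_powR_indep]); the product rule
    for expectations is Fubini's theorem for the joint law of [X] and [Y], which
    is the product of their laws ([indep_Rintegral]).

    Analyticity follows from this probabilistic representation: a Mellin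
    transform that exists on a half-plane is holomorphic there
    ([mellin_holomorphic]). Indeed
    [X^(s + h) - X^s - h ln(X) X^s] is at most [|h|^2] times a multiple of
    [X^(Re s + 2 delta) + X^(Re s - 2 delta)], which is integrable once
    [delta] is small enough for both exponents to stay in the half-plane.

    At [s = s0] the numerator and denominator arguments shifted by [- rho s0]
    coincide in pairs; the double gamma function, being an exponential, does
    not vanish, so these pairs cancel and the Mellin transform of [Y] at [s0]
    remains ([eta21_s0]). *)

(** * The complex exponential and complex differentiability *)

Section cexp.
Context (R : realType).
Implicit Types (z w : R[i]) (a b x : R).

(** The l1 norm of the plane. It is used instead of the modulus because it is
    real-valued, submultiplicative, and reduces the triangle inequality for
    complex integrals to the one for their real and imaginary parts. *)
Definition cnorm1 z : R := `|complex.Re z| + `|complex.Im z|.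

Lemma cnorm1_ge0 z : 0 <= cnorm1 z.
Proof. by rewrite addr_ge0. Qed.

Lemma cnorm1M z w : cnorm1 (z * w) <= cnorm1 z * cnorm1 w.
Proof.
case: z w => [a b] [c e]; rewrite /cnorm1 /=.
apply: (le_trans (lerD (ler_normB _ _) (ler_normD _ _))).
by rewrite !normrM; lra.
Qed.

Lemma cnorm1_le_norm z : (cnorm1 z)%:C <= 2 * `|z|.
Proof.
have le1 := normc_ge_Re z.
have le2 : `|complex.Im z|%:C <= `|z|.
  by rewrite normc_def lecR -sqrtr_sqr ler_wsqrtr// lerDr sqr_ge0.
by rewrite raddfD mulr_natl mulr2n lerD.
Qed.

Lemma norm_le_cnorm1 z : `|z| <= (cnorm1 z)%:C.
Proof.
rewrite normc_def lecR -[leRHS]ger0_norm ?cnorm1_ge0// -sqrtr_sqr ler_wsqrtr//.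
rewrite -[X in X + _ <= _]real_normK ?num_real//.
rewrite -[X in _ + X <= _]real_normK ?num_real//.
by rewrite sqrrD lerD2r lerDl mulrn_wge0// mulr_ge0.
Qed.

Lemma cexpD z w : cexp (z + w) = cexp z * cexp w.
Proof.
case: z w => [a b] [c e]; rewrite /cexp /= expRD cosD sinD.
by apply/eqP; rewrite eq_complex /=; apply/andP; split; apply/eqP; ring.
Qed.

Lemma cexp_neq0 z : cexp z != 0.
Proof.
apply/eqP => z0; have : cexp (z - z) = 0 by rewrite cexpD z0 mul0r.
rewrite subrr /cexp /= expR0 cos0 sin0 => /eqP.
by rewrite eq_complex /= mulr1 !mul0r subr0 oner_eq0.
Qed.

Lemma cnorm1_cexp z : cnorm1 (cexp z) <= 2 * expR (complex.Re z).
Proof.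
case: z => a b; rewrite /cnorm1 /cexp /= !mul0r addr0 subr0 !normrM.
rewrite (ger0_norm (expR_ge0 a)) -mulrDr mulrC ler_wpM2r ?expR_ge0//.
have lec : `|cos b| <= 1 by rewrite ler_norml cos_geN1 cos_le1.
have les : `|sin b| <= 1 by rewrite ler_norml sin_geN1 sin_le1.
lra.
Qed.

(** The mean value theorem on the segment between [0] and [x], whatever the
    sign of [x]; the remainder bounds below iterate it. *)
Lemma MVT_0 (f df : R -> R) x :
  (forall y : R, is_derive y 1 f (df y)) ->
  exists2 c, `|c| <= `|x| & f x - f 0 = df c * x.
Proof.
move=> fdf.
have cf (a b : R) : {within `[a, b], continuous f}.
  apply: continuous_subspaceT => y.
  by apply/differentiable_continuous/derivable1_diffP; have [] := fdf y.
have [x0|/ltW x0] := leP 0 x.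
  have [c] := MVT_segment x0 (fun y _ => fdf y) (cf _ _).
  rewrite in_itv /= => /andP[c0 cx] ->; exists c; last by rewrite subr0.
  by rewrite !ger0_norm.
have [c] := MVT_segment x0 (fun y _ => fdf y) (cf _ _).
rewrite in_itv /= => /andP[c0 cx] e; exists c; first by rewrite !ler0_norm ?lerN2.
by rewrite -opprB e sub0r mulrN opprK.
Qed.

Lemma sin_lip x : `|sin x| <= `|x|.
Proof.
have [c _] := @MVT_0 sin cos x (fun y => is_derive_sin y).
rewrite sin0 subr0 => ->; rewrite normrM ler_piMl//.
by rewrite ler_norml cos_geN1 cos_le1.
Qed.

Lemma cos_sub1 x : `|cos x - 1| <= x ^+ 2.
Proof.
have [c cx] := @MVT_0 cos (fun y => - sin y) x (fun y => is_derive_cos y).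
rewrite cos0 => ->; rewrite normrM normrN -normr_id -real_normK ?num_real//.
by rewrite normr_id ler_wpM2r// (le_trans (sin_lip c)).
Qed.

Lemma sin_subx x : `|sin x - x| <= x ^+ 2.
Proof.
have D (y : R) : is_derive y 1 (fun x : R => sin x - x) (cos y - 1).
  exact: is_deriveB.
have [c cx] := @MVT_0 _ _ x D.
rewrite sin0 !subr0 => ->; rewrite normrM -(real_normK (num_real x)) ler_wpM2r//.
have [k] := @MVT_0 cos (fun y => - sin y) c (fun y => is_derive_cos y).
move=> _; rewrite cos0 => ->; rewrite normrM normrN (le_trans _ cx)// ler_piMl//.
by rewrite ler_norml sin_geN1 sin_le1.
Qed.

Lemma expR_le_norm x : expR x <= expR `|x|.
Proof. by rewrite ler_expR ler_norm. Qed.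

Lemma expR_sub1 x : `|expR x - 1| <= expR `|x| * `|x|.
Proof.
have [c cx] := @MVT_0 expR expR x (fun y => is_derive_expR y).
rewrite expR0 => ->; rewrite normrM ger0_norm ?expR_ge0// ler_wpM2r//.
by rewrite (le_trans (expR_le_norm c))// ler_expR.
Qed.

Lemma expR_sub1x x : `|expR x - 1 - x| <= expR `|x| * x ^+ 2.
Proof.
have D (y : R) : is_derive y 1 (fun x : R => expR x - 1 - x) (expR y - 1).
  by rewrite -[X in X - 1]subr0; do !apply: is_deriveB.
have [c cx] := @MVT_0 _ _ x D.
rewrite expR0 subrr !subr0 => ->; rewrite normrM -(real_normK (num_real x)).
rewrite expr2 mulrA ler_wpM2r// (le_trans (expR_sub1 c))//.
by rewrite ler_pM ?expR_ge0// ler_expR.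
Qed.

(** With [z = a + ib], both components of the remainder split into real ones:
    [e^a cos b - 1 - a = e^a (cos b - 1) + (e^a - 1 - a)] and
    [e^a sin b - b = e^a (sin b - b) + (e^a - 1) b]. *)
Lemma cexp_remainder z :
  cnorm1 (cexp z - 1 - z) <= 2 * expR `|complex.Re z| * cnorm1 z ^+ 2.
Proof.
case: z => a b; rewrite /cnorm1 /cexp /= !mul0r addr0 subr0.
set E := expR `|a|; have E0 : 0 <= E := expR_ge0 _.
have aE : expR a <= E := expR_le_norm a.
have -> : expR a * cos b - 1 - a =
    expR a * (cos b - 1) + (expR a - 1 - a) by ring.
have -> : expR a * sin b - 0 - b =
    expR a * (sin b - b) + (expR a - 1) * b by ring.
have h1 : `|expR a * (cos b - 1)| <= E * `|b| ^+ 2.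
  rewrite normrM (ger0_norm (expR_ge0 _)) ler_pM ?expR_ge0//.
  by rewrite real_normK ?num_real// cos_sub1.
have h2 : `|expR a * (sin b - b)| <= E * `|b| ^+ 2.
  rewrite normrM (ger0_norm (expR_ge0 _)) ler_pM ?expR_ge0//.
  by rewrite real_normK ?num_real// sin_subx.
have h3 : `|expR a - 1 - a| <= E * `|a| ^+ 2.
  by rewrite real_normK ?num_real// expR_sub1x.
have h4 : `|(expR a - 1) * b| <= E * `|a| * `|b|.
  by rewrite normrM ler_wpM2r// expR_sub1.
apply: (le_trans (lerD (ler_normD _ _) (ler_normD _ _))).
have p1 : 0 <= E * `|a| * `|b| by rewrite !mulr_ge0.
have p2 : 0 <= E * `|a| ^+ 2 by rewrite !mulr_ge0.
nra.
Qed.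

(** A quadratic remainder forces the difference quotient to converge: it differs
    from [D] by at most [K |h|], up to the constant relating the two norms. *)
Lemma derivable_quadratic_remainder (f : R[i] -> R[i]) (z D : R[i])
    (K delta : R) :
  0 < delta ->
  (forall h, cnorm1 h <= delta ->
    cnorm1 (f (z + h) - f z - h * D) <= K * cnorm1 h ^+ 2) ->
  derivable (f : R[i]^o -> R[i]^o) z 1.
Proof.
move=> delta0 fD; apply/cvg_ex; exists (D : R[i]^o).
apply/cvgrPdist_le => eps eps0.
have [e e0 ->] : exists2 e : R, 0 < e & eps = e%:C.
  by case: eps eps0 => e e'; rewrite ltcE /= => /andP[/eqP-> e0]; exists e.
(* [cnorm1 h <= 2 |h|] costs a factor 2 in the radius and 4 in the bound;
   adding 1 to [|K|] avoids a division by zero. *)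
set r := Num.min (delta / 2) (e / (4 * (`|K| + 1))).
have K0 : 0 < `|K| + 1 by rewrite ltr_wpDl.
have r0 : 0 < r by rewrite lt_min !divr_gt0 ?mulr_gt0.
near=> h.
have h0 : h != 0 by near: h; exact: nbhs_dnbhs_neq.
have hr : `|h| < r%:C.
  by near: h; apply: dnbhs0_lt; rewrite ltcR.
have [n hn] : exists n : R, `|h| = n%:C by eexists; exact: normc_def.
have hN : cnorm1 h <= 2 * n.
  have := cnorm1_le_norm h; rewrite hn -lecR.
  by rewrite [(2 * n)%:C]rmorphM rmorph_nat.
have n0 : 0 < n by rewrite -ltcR -hn normr_gt0.
move: hr; rewrite hn ltcR lt_min => /andP[nd ne].
have hd : cnorm1 h <= delta.
  by rewrite (le_trans hN)// mulrC -ler_pdivlMr// ltW.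
have -> : D - h^-1 *: ((f \o shift z) (h%:A) - f z) =
    - (h^-1 * (f (z + h) - f z - h * D)).
  rewrite [h^-1 * (_ - h * D)]mulrBr mulKf// opprB.
  by rewrite /= -[h%:A]/(h * 1) mulr1 [h + z]addrC.
rewrite normrN normrM normfV hn ler_pdivrMl ?ltcR//.
apply: (le_trans (norm_le_cnorm1 _)); rewrite -rmorphM lecR.
apply: (le_trans (fD _ hd)).
have N0 := cnorm1_ge0 h.
apply: (@le_trans _ _ (`|K| * (2 * n) ^+ 2)).
  rewrite (le_trans (ler_wpM2r (sqr_ge0 _) (ler_norm K)))//.
  by rewrite ler_wpM2l// lerXn2r ?nnegrE// mulr_ge0// ltW.
move: ne; rewrite ltr_pdivlMr ?mulr_gt0// => ne.
have KK : `|K| * (2 * n) ^+ 2 <= n * (n * (4 * (`|K| + 1))).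
  rewrite -subr_ge0 [X in 0 <= X](_ : _ = 4 * n ^+ 2); last by ring.
  by rewrite mulr_ge0// sqr_ge0.
by rewrite (le_trans KK)// ler_wpM2l ?ltW.
Unshelve. all: by end_near.
Qed.

End cexp.

(** * Integration of complex-valued functions *)

Section cintegral.
Context d (T : measurableType d) (R : realType).
Context (mu : {measure set T -> \bar R}).
Implicit Types (f g : T -> R[i]) (c : R[i]).

(** For [f t = rcpow (X t) s] this is [mellin_integrable X s] by computation. *)
Definition cintegrable f :=
  mu.-integrable setT (fun t => (complex.Re (f t))%:E) /\
  mu.-integrable setT (fun t => (complex.Im (f t))%:E).

(** For [f t = rcpow (X t) s] this is [mellin X s] by computation. *)
Definition cintegral f : R[i] :=
  (\int[mu]_t complex.Re (f t))%R +i* (\int[mu]_t complex.Im (f t))%R.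

Lemma cintegrableD f g : cintegrable f -> cintegrable g ->
  cintegrable (fun t => f t + g t).
Proof.
move=> [fr fi] [gr gi]; split; under eq_fun do rewrite raddfD EFinD.
- exact: (integrableD measurableT fr gr).
- exact: (integrableD measurableT fi gi).
Qed.

Lemma cintegralD f g : cintegrable f -> cintegrable g ->
  cintegral (fun t => f t + g t) = cintegral f + cintegral g.
Proof.
move=> [fr fi] [gr gi]; rewrite /cintegral.
under eq_Rintegral do rewrite raddfD.
under [X in _ +i* X]eq_Rintegral do rewrite raddfD.
by rewrite !RintegralD.
Qed.

Lemma Re_mul (z w : R[i]) :
  complex.Re (z * w) =
    complex.Re z * complex.Re w - complex.Im z * complex.Im w.
Proof. by case: z w => [? ?] []. Qed.

Lemma Im_mul (z w : R[i]) :
  complex.Im (z * w) =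
    complex.Re z * complex.Im w + complex.Im z * complex.Re w.
Proof. by case: z w => [? ?] []. Qed.

Lemma Re_scale (k : R) (z : R[i]) : complex.Re (k%:C * z) = k * complex.Re z.
Proof. by rewrite Re_mul mul0r subr0. Qed.

Lemma Im_scale (k : R) (z : R[i]) : complex.Im (k%:C * z) = k * complex.Im z.
Proof. by rewrite Im_mul mul0r addr0. Qed.

Lemma cintegrableZ c f : cintegrable f -> cintegrable (fun t => c * f t).
Proof.
move=> [fr fi]; split.
- under eq_fun do rewrite Re_mul EFinB !EFinM.
  by apply: integrableB => //; exact: integrableZl.
- under eq_fun do rewrite Im_mul EFinD !EFinM.
  by apply: integrableD => //; exact: integrableZl.
Qed.

Lemma integrable_scale (k : R) (u : T -> R) :
  mu.-integrable setT (EFin \o u) ->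
  mu.-integrable setT (EFin \o (fun t => k * u t)).
Proof.
move=> ui; rewrite [EFin \o _](_ : _ = fun t => k%:E * (u t)%:E)%E//.
exact: integrableZl.
Qed.

Lemma cintegralZ c f : cintegrable f ->
  cintegral (fun t => c * f t) = c * cintegral f.
Proof.
move=> [fr fi]; rewrite /cintegral.
under eq_Rintegral do rewrite Re_mul.
under [X in _ +i* X]eq_Rintegral do rewrite Im_mul.
rewrite RintegralB ?RintegralD//; try exact: integrable_scale.
by rewrite !RintegralZl//; case: c.
Qed.

Lemma cintegrable_le f (g : T -> R) :
  measurable_fun setT (fun t => complex.Re (f t)) ->
  measurable_fun setT (fun t => complex.Im (f t)) ->
  mu.-integrable setT (EFin \o g) -> (forall t, cnorm1 (f t) <= g t) ->
  cintegrable f.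
Proof.
move=> mr mi gi fg; split.
- apply: (le_integrable measurableT _ _ gi); first exact/measurable_EFinP.
  move=> t _; rewrite /= lee_fin (le_trans _ (ler_norm _))//.
  by rewrite (le_trans _ (fg t))// lerDl.
- apply: (le_integrable measurableT _ _ gi); first exact/measurable_EFinP.
  move=> t _; rewrite /= lee_fin (le_trans _ (ler_norm _))//.
  by rewrite (le_trans _ (fg t))// lerDr.
Qed.

Lemma cnorm1_cintegral f (g : T -> R) : cintegrable f ->
  mu.-integrable setT (EFin \o g) -> (forall t, cnorm1 (f t) <= g t) ->
  cnorm1 (cintegral f) <= \int[mu]_t g t.
Proof.
move=> [fr fi] gi fg; rewrite /cnorm1 /cintegral /=.
have nr := integrable_norm fr; have ni := integrable_norm fi.
apply: (le_trans (lerD (le_normr_Rintegral _ fr) (le_normr_Rintegral _ fi))) => //.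
rewrite -RintegralD//; apply: le_Rintegral => //.
  exact: (integrableD measurableT nr ni).
by move=> t _; exact: fg.
Qed.

End cintegral.

(** * Mellin transforms are holomorphic *)

Section mellin_holomorphic.
Context d (T : measurableType d) (R : realType) (P : probability T R).
Implicit Types (X : T -> R) (s h : R[i]) (x y : R).

Lemma rcpowE x s : rcpow x s = cexp (s * (ln x)%:C). Proof. by []. Qed.

Lemma Re_rcpow x s :
  complex.Re (rcpow x s) =
    expR (complex.Re s * ln x) * cos (complex.Im s * ln x).
Proof.
case: s => a b.
by rewrite /rcpow /cexp /= !(mulr0, mul0r, subr0, add0r).
Qed.

Lemma Im_rcpow x s :
  complex.Im (rcpow x s) =
    expR (complex.Re s * ln x) * sin (complex.Im s * ln x).
Proof.
case: s => a b.
by rewrite /rcpow /cexp /= !(mulr0, mul0r, subr0, add0r, addr0).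
Qed.

Lemma measurable_Re_rcpow s :
  measurable_fun setT (fun x => complex.Re (rcpow x s)).
Proof.
under eq_fun do rewrite Re_rcpow.
have mZ (k : R) : measurable_fun setT (fun x : R => k * ln x).
  by apply: measurable_funM => //; exact: measurable_ln.
apply: measurable_funM; first exact: measurableT_comp.
apply: measurableT_comp => //.
exact: continuous_measurable_fun (@continuous_cos R).
Qed.

Lemma measurable_Im_rcpow s :
  measurable_fun setT (fun x => complex.Im (rcpow x s)).
Proof.
under eq_fun do rewrite Im_rcpow.
have mZ (k : R) : measurable_fun setT (fun x : R => k * ln x).
  by apply: measurable_funM => //; exact: measurable_ln.
apply: measurable_funM; first exact: measurableT_comp.
apply: measurableT_comp => //.
exact: continuous_measurable_fun (@continuous_sin R).
Qed.

Lemma cnorm1_rcpow x s : cnorm1 (rcpow x s) <= 2 * expR (complex.Re s * ln x).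
Proof.
rewrite (le_trans (cnorm1_cexp _))//.
by rewrite Re_mul /= mulr0 subr0.
Qed.

Lemma integrable_expR_ln X (a : R) : mellin_integrable P X a%:C ->
  P.-integrable setT (fun t => (expR (a * ln (X t)))%:E).
Proof.
by move=> [+ _]; under eq_fun do rewrite Re_rcpow /= mul0r cos0 mulr1.
Qed.

Lemma expR_norm_le x : expR `|x| <= expR x + expR (- x).
Proof.
by case: (ger0P x) => _; rewrite ?lerDl ?lerDr expR_ge0.
Qed.

(** Squaring [delta / 2 |x| <= exp (delta / 2 |x|)]. *)
Lemma sqr_le_expR (delta x : R) : 0 < delta ->
  x ^+ 2 <= 4 / delta ^+ 2 * expR (delta * `|x|).
Proof.
move=> d0.
have h : delta / 2 * `|x| <= expR (delta / 2 * `|x|).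
  by rewrite (le_trans _ (expR_ge1Dx _))// lerDr.
have : (delta / 2 * `|x|) ^+ 2 <= expR (delta * `|x|).
  have -> : delta * `|x| = delta / 2 * `|x| + delta / 2 * `|x| by field.
  by rewrite expRD expr2 ler_pM// mulr_ge0// divr_ge0// ltW.
rewrite exprMn real_normK ?num_real// => k.
rewrite -ler_pdivrMl ?divr_gt0 ?exprn_gt0//.
suff -> : (4 / delta ^+ 2)^-1 = (delta / 2) ^+ 2 by [].
by field; rewrite gt_eqF.
Qed.

(** Moving an exponent by [eps] in either direction absorbs a factor
    [exp (eps |x|)], hence any power of [x]: this is what turns the size of
    [ln X] into integrability of nearby powers of [X]. *)
Lemma expR_strip (a eps x : R) : 0 <= eps ->
  expR (a * x) * expR (eps * `|x|) <=
    expR ((a + eps) * x) + expR ((a - eps) * x).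
Proof.
move=> e0; rewrite mulrDl mulrBl !expRD -mulrDr ler_wpM2l ?expR_ge0//.
by rewrite -[eps in leLHS]ger0_norm// -normrM expR_norm_le.
Qed.

Lemma cnorm1_real x : cnorm1 x%:C = `|x|.
Proof. by rewrite /cnorm1 /= normr0 addr0. Qed.

(** The remainder is [x^s (e^(hL) - 1 - hL)] with [L = ln x]. The exponential
    bound produces [|h|^2 L^2 e^(delta |L|)]; trading [L^2] for a second factor
    [e^(delta |L|)] explains the shift by [2 delta]. The constant 16 collects
    2 from [cnorm1_cexp], 2 from [cexp_remainder], 4 from [sqr_le_expR]. *)
Lemma rcpow_remainder (delta x : R) s h :
  0 < delta -> `|complex.Re h| <= delta ->
  cnorm1 (rcpow x (s + h) - rcpow x s - h * ((ln x)%:C * rcpow x s)) <=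
  16 / delta ^+ 2 * cnorm1 h ^+ 2 *
    (expR ((complex.Re s + 2 * delta) * ln x) +
     expR ((complex.Re s - 2 * delta) * ln x)).
Proof.
move=> d0 hd; set L := ln x.
rewrite [X in cnorm1 X](_ : _ =
    rcpow x s * (cexp (h * L%:C) - 1 - h * L%:C)); last first.
  by rewrite !rcpowE mulrDl cexpD; ring.
have Rh : `|complex.Re (h * L%:C)| <= delta * `|L|.
  by rewrite Re_mul /= mulr0 subr0 normrM ler_wpM2r.
set E := expR (delta * `|L|); have E0 : 0 <= E := expR_ge0 _.
have Eh : expR `|complex.Re (h * L%:C)| <= E by rewrite ler_expR.
have N2 : cnorm1 (h * L%:C) ^+ 2 <= cnorm1 h ^+ 2 * (4 / delta ^+ 2 * E).
  apply: (@le_trans _ _ ((cnorm1 h * `|L|) ^+ 2)).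
    rewrite lerXn2r ?nnegrE ?mulr_ge0 ?cnorm1_ge0//.
    by rewrite -cnorm1_real cnorm1M.
  by rewrite exprMn real_normK ?num_real// ler_wpM2l ?sqr_ge0// sqr_le_expR.
apply: (le_trans (cnorm1M _ _)).
have strip := expR_strip (complex.Re s) L (mulr_ge0 (ler0n _ 2) (ltW d0)).
have EE : expR (2 * delta * `|L|) = E * E.
  by rewrite /E -expRD; congr expR; ring.
apply: (@le_trans _ _ ((2 * expR (complex.Re s * L)) *
    (2 * E * (cnorm1 h ^+ 2 * (4 / delta ^+ 2 * E))))).
  rewrite ler_pM ?cnorm1_ge0 ?cnorm1_rcpow//.
  apply: (le_trans (cexp_remainder _)).
  by apply: ler_pM N2; rewrite ?sqr_ge0 ?mulr_ge0 ?expR_ge0// ler_wpM2l.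
rewrite [leLHS](_ : _ = 16 / delta ^+ 2 * cnorm1 h ^+ 2 *
    (expR (complex.Re s * L) * (E * E))); last by ring.
by rewrite -EE ler_wpM2l// mulr_ge0 ?sqr_ge0// divr_ge0 ?sqr_ge0.
Qed.

Lemma cnorm1_ln_rcpow (delta x : R) s : 0 < delta ->
  cnorm1 ((ln x)%:C * rcpow x s) <= 2 / delta *
    (expR ((complex.Re s + delta) * ln x) +
     expR ((complex.Re s - delta) * ln x)).
Proof.
move=> d0; set L := ln x.
have h : delta * `|L| <= expR (delta * `|L|).
  by rewrite (le_trans _ (expR_ge1Dx _))// lerDr.
have strip := expR_strip (complex.Re s) L (ltW d0).
apply: (le_trans (cnorm1M _ _)); rewrite cnorm1_real.
apply: (@le_trans _ _ (delta^-1 * expR (delta * `|L|) *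
    (2 * expR (complex.Re s * L)))).
  by rewrite ler_pM ?cnorm1_ge0 ?cnorm1_rcpow// ler_pdivlMl.
rewrite [leLHS](_ : _ = 2 / delta * (expR (complex.Re s * L) *
   expR (delta * `|L|))); last by ring.
by rewrite ler_wpM2l// divr_ge0// ltW.
Qed.

(** Differentiation under the expectation. The derivative is [E[ln(X) X^s]];
    integrating [rcpow_remainder] bounds the error quadratically. *)
Lemma mellin_holomorphic X (a : R) (phi : R[i] -> R[i]) :
  has_mellin_on P X [set s | a < complex.Re s] phi ->
  holomorphic_on [set s | a < complex.Re s] phi.
Proof.
move=> [[mX _] phiP] s /= sa.
(* a quarter of the distance to the boundary, so that the exponents shifted
   by [2 delta] remain in the half-plane *)
have [delta d0 sE] : exists2 delta : R,
    0 < delta & complex.Re s = a + 4 * delta.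
  exists ((complex.Re s - a) / 4); first by rewrite divr_gt0// subr_gt0.
  by rewrite mulrC divfK// addrC subrK.
have near_s (e : R) : `|e| <= 2 * delta -> a < complex.Re s + e.
  by rewrite ler_norml sE => /andP[eN _]; lra.
set G := fun eps t => expR ((complex.Re s + eps) * ln (X t)) +
                      expR ((complex.Re s - eps) * ln (X t)).
have Gi eps : 0 < eps -> eps <= 2 * delta -> P.-integrable setT (EFin \o G eps).
  move=> e0 e2.
  have en : `|eps| <= 2 * delta by rewrite gtr0_norm.
  have := integrable_expR_ln (phiP ((complex.Re s + eps)%:C) (near_s _ en)).1.
  rewrite -normrN in en.
  have := integrable_expR_ln (phiP ((complex.Re s - eps)%:C) (near_s _ en)).1.
  by move=> i1 i2; exact: (integrableD measurableT i2 i1).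
pose F := fun t => (ln (X t))%:C * rcpow (X t) s.
have iF : cintegrable P F.
  apply: (cintegrable_le (g := fun t => 2 / delta * G delta t)).
  - rewrite [X in measurable_fun _ X](_ : _ =
        fun t => ln (X t) * complex.Re (rcpow (X t) s)); last first.
      by apply/funext => t; rewrite Re_scale.
    apply: measurable_funM; first exact: (measurableT_comp (@measurable_ln R)).
    exact: (measurableT_comp (measurable_Re_rcpow s)).
  - rewrite [X in measurable_fun _ X](_ : _ =
        fun t => ln (X t) * complex.Im (rcpow (X t) s)); last first.
      by apply/funext => t; rewrite Im_scale.
    apply: measurable_funM; first exact: (measurableT_comp (@measurable_ln R)).
    exact: (measurableT_comp (measurable_Im_rcpow s)).
  - by apply: integrable_scale; apply: Gi => //; rewrite ler_peMl ?ler1n// ltW.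
  - by move=> t; exact: cnorm1_ln_rcpow.
apply: (@derivable_quadratic_remainder _ phi s (cintegral P F)
   (16 / delta ^+ 2 * \int[P]_t G (2 * delta) t) delta d0) => h hd.
have hd1 : `|complex.Re h| <= delta by rewrite (le_trans _ hd)// lerDl.
have Dsh : a < complex.Re (s + h).
  by rewrite raddfD near_s// (le_trans hd1)// ler_peMl ?ler1n// ltW.
have [i0 e0] := phiP _ sa; have [ih eh] := phiP _ Dsh.
have -> : phi (s + h) - phi s - h * cintegral P F =
    cintegral P (fun t => rcpow (X t) (s + h) +
      ((-1) * rcpow (X t) s + (- h) * F t)).
  have i1 := cintegrableZ (-1) i0; have i2 := cintegrableZ (-h) iF.
  rewrite cintegralD ?cintegralD ?cintegralZ//; last exact: cintegrableD.
  by rewrite -eh -e0 /mellin /cintegral; ring.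
rewrite mulrAC -RintegralZl//; last first.
  by apply: Gi => //; rewrite mulr_gt0.
apply: cnorm1_cintegral.
- apply: cintegrableD => //; apply: cintegrableD; exact: cintegrableZ.
- by apply: integrable_scale; apply: Gi => //; rewrite mulr_gt0.
- move=> t; rewrite mulN1r mulNr addrA; exact: rcpow_remainder.
Qed.

End mellin_holomorphic.

(** * Expectations of products of independent variables *)

Section joint_law.
Context d (T : measurableType d) (R : realType) (P : probability T R).

Definition joint_rv (X Y : {RV P >-> R}) (t : T) : R * R := (X t, Y t).

Lemma measurable_joint_rv X Y : measurable_fun setT (joint_rv X Y).
Proof. exact: measurable_fun_pair. Qed.

HB.instance Definition _ X Y :=
  isMeasurableFun.Build _ _ _ _ (joint_rv X Y) (measurable_joint_rv X Y).

End joint_law.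

Section independence.
Context d (T : measurableType d) (R : realType) (P : probability T R).
Implicit Types (X Y : {RV P >-> R}).
Local Open Scope ereal_scope.

(** Independence is the product rule on rectangles, which determines a finite
    measure on the plane. *)
Lemma joint_law_indep X Y (A : set (R * R)) :
  independent_rv P X Y -> measurable A ->
  (distribution P X \x distribution P Y) A = distribution P (joint_rv X Y) A.
Proof.
by move=> indep; apply: product_measure_unique => B C mB mC; exact: indep.
Qed.

(** Tonelli under the product of the laws gives integrability of
    [f(x) g(y)], Fubini then evaluates its integral. *)
Lemma indep_Rintegral X Y (f g : R -> R) :
  independent_rv P X Y ->
  measurable_fun setT f -> measurable_fun setT g ->
  P.-integrable setT (fun t => (f (X t))%:E) ->
  P.-integrable setT (fun t => (g (Y t))%:E) ->
  P.-integrable setT (fun t => (f (X t) * g (Y t))%:E) /\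
  (\int[P]_t (f (X t) * g (Y t)) =
   (\int[P]_t f (X t)) * (\int[P]_t g (Y t)))%R.
Proof.
move=> indep mf mg fi gi.
pose h (z : R * R) := (f z.1 * g z.2)%:E.
have mh : measurable_fun setT h.
  apply/measurable_EFinP/measurable_funM.
  - exact: (measurableT_comp mf measurable_fst).
  - exact: (measurableT_comp mg measurable_snd).
have mfE : measurable_fun setT (EFin \o f) by exact/measurable_EFinP.
have mgE : measurable_fun setT (EFin \o g) by exact/measurable_EFinP.
have fX : (distribution P X).-integrable setT (EFin \o f).
  exact: integrable_pushforward.
have gY : (distribution P Y).-integrable setT (EFin \o g).
  exact: integrable_pushforward.
have hi : (distribution P X \x distribution P Y).-integrable setT h.
  apply/integrable12ltyP => //.
  have cE x : \int[distribution P Y]_y `|h (x, y)| =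
      `|(f x)%:E| * \int[distribution P Y]_y `|(g y)%:E|.
    rewrite -ge0_integralZl//; last exact: measurableT_comp.
    by apply: eq_integral => y _; rewrite /h /= normrM EFinM.
  under eq_integral do rewrite cE.
  have [_ /= gY1] := integrableP _ _ _ gY.
  have [_ /= fX1] := integrableP _ _ _ fX.
  rewrite ge0_integralZr//; last 2 first.
  - exact/measurable_EFinP/(measurableT_comp (@normr_measurable _ setT)).
  - by apply: integral_ge0.
  by rewrite lte_mul_pinfty ?integral_ge0// ge0_fin_numE// integral_ge0.
have hP : P.-integrable setT (h \o joint_rv X Y).
  have [_ hi1] := integrableP _ _ _ hi.
  apply/integrableP; split; first exact: measurableT_comp.
  have mh1 : measurable_fun setT (abse \o h) by exact: measurableT_comp.
  rewrite -(@ge0_integral_distribution _ _ _ _ _ P (joint_rv X Y) (abse \o h))//;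
    last by move=> z; exact: abse_ge0.
  rewrite (eq_measure_integral (distribution P X \x distribution P Y))//.
  by move=> A mA _; exact/esym/joint_law_indep.
split; first exact: hP.
apply: EFin_inj; rewrite EFinM.
have fX' := integral_distribution mfE fi.
have gY' := integral_distribution mgE gi.
rewrite /Rintegral !fineK ?integrable_fin_num//.
rewrite -[LHS](integral_distribution mh hP).
rewrite -[X in X * _]fX' -[X in _ * X]gY'.
transitivity (\int[distribution P X \x distribution P Y]_z h z).
  by apply: eq_measure_integral => A mA _; exact/esym/joint_law_indep.
have gfin := integrable_fin_num measurableT gY.
rewrite -integral12_prod_meas1// -[X in _ * X](fineK gfin) -integralZr//.
apply: eq_integral => x _; rewrite fineK// -integralZl//.
Qed.

End independence.

(** The real product rule applied to the four products of components. *)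
Lemma indep_cintegral d (T : measurableType d) (R : realType)
    (P : probability T R) (X Y : {RV P >-> R}) (f g : R -> R[i]) :
  independent_rv P X Y ->
  measurable_fun setT (fun x => complex.Re (f x)) ->
  measurable_fun setT (fun x => complex.Im (f x)) ->
  measurable_fun setT (fun x => complex.Re (g x)) ->
  measurable_fun setT (fun x => complex.Im (g x)) ->
  cintegrable P (f \o X) -> cintegrable P (g \o Y) ->
  cintegrable P (fun t => f (X t) * g (Y t)) /\
  cintegral P (fun t => f (X t) * g (Y t)) =
    cintegral P (f \o X) * cintegral P (g \o Y).
Proof.
move=> indep mfr mfi mgr mgi [fr fi] [gr gi].
have [irr err] := indep_Rintegral indep mfr mgr fr gr.
have [iri eri] := indep_Rintegral indep mfr mgi fr gi.
have [iir eir] := indep_Rintegral indep mfi mgr fi gr.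
have [iii eii] := indep_Rintegral indep mfi mgi fi gi.
split.
  split.
  - by under eq_fun do rewrite Re_mul EFinB; exact: integrableB.
  - by under eq_fun do rewrite Im_mul EFinD; exact: integrableD.
rewrite /cintegral.
under eq_Rintegral do rewrite Re_mul.
under [X in _ +i* X]eq_Rintegral do rewrite Im_mul.
by rewrite RintegralB// RintegralD// err eri eir eii.
Qed.

Lemma ae_eq_Rintegral d (T : measurableType d) (R : realType)
    (mu : {measure set T -> \bar R}) (u v : T -> R) :
  measurable_fun setT u -> {ae mu, forall t, u t = v t} ->
  mu.-integrable setT (fun t => (v t)%:E) ->
  mu.-integrable setT (fun t => (u t)%:E) /\
  (\int[mu]_t u t = \int[mu]_t v t)%R.
Proof.
move=> msu uv vi.
have mv := measurable_int mu vi.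
have muE : measurable_fun setT (fun t => (u t)%:E) by exact/measurable_EFinP.
have uvE : ae_eq mu setT (fun t => (u t)%:E) (fun t => (v t)%:E).
  by apply: filterS uv => t /= -> _.
split; last first.
  by rewrite /Rintegral (ae_eq_integral (fun t => (v t)%:E)).
have [_ vi1] := integrableP _ _ _ vi.
apply/integrableP; split => //.
rewrite (ae_eq_integral (abse \o (fun t => (v t)%:E)))//.
- exact: measurableT_comp.
- exact: measurableT_comp.
- exact: ae_eq_abse.
Qed.

Lemma ae_eq_cintegral d (T : measurableType d) (R : realType)
    (mu : {measure set T -> \bar R}) (u v : T -> R[i]) :
  measurable_fun setT (fun t => complex.Re (u t)) ->
  measurable_fun setT (fun t => complex.Im (u t)) ->
  {ae mu, forall t, u t = v t} -> cintegrable mu v ->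
  cintegrable mu u /\ cintegral mu u = cintegral mu v.
Proof.
move=> mr mi uv [vr vi].
have aeRe : {ae mu, forall t, complex.Re (u t) = complex.Re (v t)}.
  by apply: filterS uv => t ->.
have aeIm : {ae mu, forall t, complex.Im (u t) = complex.Im (v t)}.
  by apply: filterS uv => t ->.
have [ir er] := ae_eq_Rintegral mr aeRe vr.
have [ii ei] := ae_eq_Rintegral mi aeIm vi.
by split=> //; rewrite /cintegral er ei.
Qed.

Lemma rcpow_powR (R : realType) (x y a b : R) (s : R[i]) : 0 < x -> 0 < y ->
  rcpow (x `^ a * y `^ b) s = rcpow x (s * a%:C) * rcpow y (s * b%:C).
Proof.
move=> x0 y0; rewrite /rcpow -cexpD; congr cexp.
rewrite lnM ?posrE ?powR_gt0// !ln_powR.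
by rewrite rmorphD !rmorphM; ring.
Qed.

Lemma positive_rv_powR d (T : measurableType d) (R : realType)
    (P : probability T R) (X Y : T -> R) (a b : R) :
  positive_rv P X -> positive_rv P Y ->
  positive_rv P (fun t => X t `^ a * Y t `^ b).
Proof.
move=> [mX X0] [mY Y0]; split.
  apply: measurable_funM.
  - exact: (measurableT_comp (measurable_powR a)).
  - exact: (measurableT_comp (measurable_powR b)).
by apply: filterS2 X0 Y0 => t x0 y0; rewrite mulr_gt0// powR_gt0.
Qed.

(** The factorization of powers needs positive bases, so it holds only almost
    surely. *)
Lemma mellin_powR_indep d (T : measurableType d) (R : realType)
    (P : probability T R) (X Y : {RV P >-> R}) (a b : R) (s : R[i]) :
  independent_rv P X Y -> positive_rv P X -> positive_rv P Y ->
  mellin_integrable P X (s * a%:C) -> mellin_integrable P Y (s * b%:C) ->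
  mellin_integrable P (fun t => X t `^ a * Y t `^ b) s /\
  mellin P (fun t => X t `^ a * Y t `^ b) s =
    mellin P X (s * a%:C) * mellin P Y (s * b%:C).
Proof.
move=> indep X0 Y0 Xi Yi; have [mW _] := positive_rv_powR a b X0 Y0.
have [i <-] := indep_cintegral indep
  (measurable_Re_rcpow _) (measurable_Im_rcpow _)
  (measurable_Re_rcpow _) (measurable_Im_rcpow _) Xi Yi.
apply: (ae_eq_cintegral _ _ _ i).
- exact: (measurableT_comp (measurable_Re_rcpow s) mW).
- exact: (measurableT_comp (measurable_Im_rcpow s) mW).
- by apply: filterS2 X0.2 Y0.2 => t; exact: rcpow_powR.
Qed.

(** * The deformed Mellin transform *)

Lemma barnes_gamma2_neq0 (R : realType) (w : R[i]) (tau : R) :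
  barnes_gamma2 w tau != 0.
Proof. exact: cexp_neq0. Qed.

Lemma eta21E (R : realType) (tau b0 b1 s0 rho : R) (s : R[i]) :
  eta21 tau b0 b1 s0 s rho =
    beta21_mellin tau (b0 - rho * s0) b1 (s * (1 + rho)%:C) *
    beta21_mellin tau b0 b1 (s * (- rho)%:C).
Proof.
have e1 : b0 + b1 - rho * s0 = b0 - rho * s0 + b1 by ring.
have e2 : - rho%:C * s = s * (- rho)%:C.
  by rewrite mulrC; congr (_ * _); apply/eqP; rewrite eq_complex /= oppr0 !eqxx.
rewrite /eta21 /beta21_mellin e1 e2.
(* abstracted, because [barnes_gamma2] itself unfolds to a product *)
by move: (@barnes_gamma2 R) => G; rewrite !mulrA.
Qed.

(** The four factors shifted by [- rho s0] cancel in pairs. *)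
Lemma eta21_s0 (R : realType) (tau b0 b1 s0 rho : R) :
  eta21 tau b0 b1 s0 s0%:C rho = beta21_mellin tau b0 b1 s0%:C.
Proof.
have E1 (c : R) : s0%:C * (1 + rho)%:C + (c - rho * s0)%:C = s0%:C + c%:C.
  by apply/eqP; rewrite eq_complex /=; apply/andP; split; apply/eqP; ring.
have E2 (c : R) : - rho%:C * s0%:C + c%:C = (c - rho * s0)%:C.
  by apply/eqP; rewrite eq_complex /=; apply/andP; split; apply/eqP; ring.
rewrite /eta21 /beta21_mellin !E1 !E2.
have := @barnes_gamma2_neq0 R.
move: (@barnes_gamma2 R) => G G0; field.
by rewrite !G0.
Qed.

Lemma convex_comb_gt0 (R : realType) (t u v : R) :
  0 <= t -> t <= 1 -> 0 < u -> 0 < v -> 0 < t * u + (1 - t) * v.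
Proof.
move=> t0 t1 u0 v0; have [->|tN0] := eqVneq t 0.
  by rewrite mul0r add0r subr0 mul1r.
rewrite ltr_pwDl//; first by rewrite mulr_gt0// lt_def tN0.
by apply: mulr_ge0; [rewrite subr_ge0|exact: ltW].
Qed.

Theorem lemma5p4 (R : realType) (gamma tau b0 b1 rho s0 : R)
    (d : measure_display) (T : measurableType d) (P : probability T R)
    (X Y : {RV P >-> R}) :
  0 < gamma -> gamma < 2 -> tau = 4 / gamma ^+ 2 ->
  0 < b0 -> 0 < b1 ->
  -1 <= rho -> rho <= 0 -> 0 < s0 + b0 ->
  is_barnes_beta21 P tau (b0 - rho * s0) b1 X ->
  is_barnes_beta21 P tau b0 b1 Y ->
  independent_rv P X Y ->
  [/\ holomorphic_on [set s | 0 < complex.Re s + b0]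
        (fun s => eta21 tau b0 b1 s0 s rho),
      has_mellin_on P (fun t => X t `^ (1 + rho) * Y t `^ (- rho))
        [set s | 0 < complex.Re s + b0]
        (fun s => eta21 tau b0 b1 s0 s rho) &
      eta21 tau b0 b1 s0 s0%:C rho = mellin P Y s0%:C].
Proof.
move=> _ _ _ b00 _ rho1 rho0 s0b0 [X0 Xphi] [Y0 Yphi] indep.
have W : has_mellin_on P (fun t => X t `^ (1 + rho) * Y t `^ (- rho))
    [set s | 0 < complex.Re s + b0] (fun s => eta21 tau b0 b1 s0 s rho).
  split; first exact: positive_rv_powR.
  move=> s /= sb0.
  have [Xi Xe] : mellin_integrable P X (s * (1 + rho)%:C) /\
      mellin P X (s * (1 + rho)%:C) =
      beta21_mellin tau (b0 - rho * s0) b1 (s * (1 + rho)%:C).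
    apply: Xphi; rewrite /mkset [s * _]mulrC Re_scale -subr_gt0.
    rewrite [ltRHS](_ : _ = (1 + rho) * (complex.Re s + b0) +
      (1 - (1 + rho)) * (s0 + b0)); last by ring.
    by apply: convex_comb_gt0 => //; lra.
  have [Yi Ye] : mellin_integrable P Y (s * (- rho)%:C) /\
      mellin P Y (s * (- rho)%:C) = beta21_mellin tau b0 b1 (s * (- rho)%:C).
    apply: Yphi; rewrite /mkset [s * _]mulrC Re_scale -subr_gt0.
    rewrite [ltRHS](_ : _ = - rho * (complex.Re s + b0) +
      (1 - - rho) * b0); last by ring.
    by apply: convex_comb_gt0 => //; lra.
  have [Wi ->] := mellin_powR_indep indep X0 Y0 Xi Yi.
  by rewrite Xe Ye eta21E.
split => //.
- move: W; rewrite (_ : [set s | 0 < complex.Re s + b0] =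
      [set s | - b0 < complex.Re s]).
    exact: mellin_holomorphic.
  by apply/funext => s; rewrite /mkset -ltrBlDr sub0r.
- rewrite eta21_s0; apply/esym/(proj2 (Yphi _ _)).
  by rewrite /=; lra.
Qed.
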